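(* Let $(M_n)$ be a weight sequence, suppose that $\phi:[0,1]\to[0,1]$ induces a compact endomorphism $T$ of $D([0,1],M)$, and let $x_0$ be the unique fixed point of $\phi$. Then the spectrum of $T$ is $$\sigma(T)=\{(\phi'(x_0))^n : n \text{ is a positive integer}\}\cup\{0,1\}.$$
   Context: A weight sequence is a sequence $(M_n)_{n\ge 0}$ of positive real numbers with $M_0=1$ and $\frac{M_{n+m}}{M_nM_m}\ge\binom{n+m}{m}$ for all non-negative integers $m,n$. $D([0,1],M)$ is the set of complex-valued infinitely differentiable functions $f$ on $[0,1]$ (one-sided derivatives at endpoints) with $\|f\|_D=\sum_{n=0}^\infty \frac{\|f^{(n)}\|_\infty}{M_n}<\infty$, where $\|\cdot\|_\infty$ is the supremum norm on $[0,1]$; with pointwise operations and the norm $\|\cdot\|_D$ it is a unital commutative semisimple Banach algebra. A map $\phi:[0,1]\to[0,1]$ induces an endomorphism of $D([0,1],M)$ if $f\circ\phi\in D([0,1],M)$ for every $f\in D([0,1],M)$; the endomorphism is then $T:f\mapsto f\circ\phi$ (automatically continuous), and $\phi$ induces a compact endomorphism if moreover $T$ is a compact operator. Since $f(x)=x$ lies in $D([0,1],M)$, such a $\phi$ automatically lies in $D([0,1],M)$, so $\phi'$ makes sense. It is a known fact that if $\phi$ induces a compact endomorphism then, with $\phi_n$ denoting the $n$-th iterate of $\phi$, $\bigcap_{n\ge0}\phi_n([0,1])=\{x_0\}$ for a point $x_0$ that is the unique fixed point of $\phi$. $\sigma(T)$ denotes the spectrum of $T$ as a bounded operator on $D([0,1],M)$.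 *)

(* Defs.v *)
From HB Require Import structures.
From mathcomp Require Import all_boot all_order all_algebra complex.
From mathcomp Require Import all_classical all_reals all_analysis.

Set Implicit Arguments.
Unset Strict Implicit.
Unset Printing Implicit Defensive.

Import Order.TTheory GRing.Theory Num.Theory.
Import numFieldNormedType.Exports.
Import ComplexField.

Local Open Scope classical_set_scope.
Local Open Scope ring_scope.
Local Open Scope complex_scope.

Notation unit_interval R := (set_type (`[0%R, 1%R]%classic : set R)).

(* The normed module structure of R[i] is carried by its regular algebra
   R[i]^o. *)
Notation cfun R := (unit_interval R -> (R[i])^o).

Record weight_seq (R : realType) := WeightSeq {
  weight :> nat -> R;
  weight_gt0 : forall n, 0 < weight n;
  weight0 : weight 0%N = 1;
  weight_bin : forall m n,
    'C(n + m, m)%:R <= weight (n + m)%N / (weight n * weight m)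
}.

Section D_algebra.
Context {R : realType}.
Implicit Types (f g : cfun R) (x : unit_interval R).

Definition diff_quotient f x (y : unit_interval R) : (R[i])^o :=
  ((\val y - \val x)%:C)^-1 *: (f y - f x).

(* x^' is the punctured neighbourhood filter of x inside [0, 1], so this is the
   one-sided derivative when x is an endpoint. *)
Definition cderivable f x := cvg (diff_quotient f x @ x^').
Definition cderiv f x : (R[i])^o := lim (diff_quotient f x @ x^').

(* lim is a junk value where the limit does not exist, so this is the n-th
   derivative only for smooth f. *)
Definition cderivn n f : cfun R := iter n cderiv f.

Definition smooth f := forall n x, cderivable (cderivn n f) x.

Definition supnorm f : \bar R :=
  ereal_sup [set (Normc.normc (f x))%:E | x in setT].

Definition Dnorm (M : weight_seq R) f : \bar R :=
  (\sum_(0 <= n <oo) supnorm (cderivn n f) * ((M n)^-1)%:E)%E.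

Definition in_D (M : weight_seq R) : {pred cfun R} :=
  [pred f | `[< smooth f /\ (Dnorm M f < +oo)%E >]].

Lemma dnbhs_unit_interval_proper x : ProperFilter x^'.
Proof.
apply: Build_ProperFilter_ex => P; rewrite /dnbhs /within/= => /nbhs_ballP.
move=> [e /= e0 xP].
have /andP[x0 x1] : 0 <= \val x <= 1.
  by have /set_mem := valP x; rewrite /= in_itv.
pose d := Num.min (e / 2) (1 / 2).
have d0 : 0 < d by rewrite lt_min !divr_gt0.
have de : d < e by rewrite gt_min ltr_pdivrMr// ltr_pMr// ltr1n.
have d2 : d <= 1 / 2 by rewrite ge_min lexx orbT.
have near_x z : 0 <= z <= 1 -> `|\val x - z| = d -> exists y, P y.
  move=> z01' zd; have z01 : z \in `[0, 1]%classic.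
    by rewrite inE /= in_itv.
  pose y : unit_interval R := exist _ z z01.
  exists y; apply: xP => /=.
    by rewrite -initial_ballE/= /ball/= set_valE/= zd.
  by apply: contra_eq_neq zd => <-; rewrite subrr normr0 lt_eqF.
case: (lerP (\val x) (1 / 2)) => x2.
  apply: (near_x (\val x + d)).
    by rewrite addr_ge0 ?(ltW d0)//= (le_trans (lerD x2 d2))// -splitr.
  by rewrite opprD addrA subrr sub0r normrN gtr0_norm.
apply: (near_x (\val x - d)).
  by rewrite subr_ge0 (le_trans d2 (ltW x2))/= lerBlDr (le_trans x1)// lerDl ltW.
by rewrite opprB addrCA subrr addr0 gtr0_norm.
Qed.

#[local] Instance dnbhs_unit_interval x : ProperFilter x^' :=
  dnbhs_unit_interval_proper x.

Lemma diff_quotient_linear a f g x :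
  diff_quotient (a *: f + g) x = a *: diff_quotient f x + diff_quotient g x.
Proof.
apply/funext => y; rewrite /diff_quotient !fctE opprD addrACA -scalerBr scalerDr.
by rewrite !scalerA mulrC.
Qed.

Lemma cderiv_linear a f g x : cderivable f x -> cderivable g x ->
  diff_quotient (a *: f + g) x @ x^' --> (a *: cderiv f x + cderiv g x : (R[i])^o).
Proof.
move=> df dg; rewrite diff_quotient_linear.
have xF : Filter x^' by exact: filter_filter.
exact: (cvgD (cvgZl_tmp (k := a) df) dg).
Qed.

Lemma cderivn_linear a f g n : smooth f -> smooth g ->
  cderivn n (a *: f + g) = a *: cderivn n f + cderivn n g.
Proof.
move=> sf sg; elim: n => [//|n IHn]; rewrite /cderivn !iterS -!/(cderivn n _).
rewrite IHn; apply/funext => x; apply: cvg_lim; first exact: norm_hausdorff.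
exact: cderiv_linear.
Qed.

Lemma smooth_linear a f g : smooth f -> smooth g -> smooth (a *: f + g).
Proof.
move=> sf sg n x; rewrite cderivn_linear//.
by apply/cvg_ex; eexists; exact: cderiv_linear.
Qed.

Lemma cderivn0 n : cderivn n (0 : cfun R) = 0.
Proof.
elim: n => [//|n IHn]; rewrite /cderivn iterS -/(cderivn n _) IHn.
apply/funext => x; apply: cvg_lim; first exact: norm_hausdorff.
rewrite (_ : diff_quotient _ _ = cst 0); first exact: cvg_cst.
by apply/funext => y; rewrite /diff_quotient !fctE subrr scaler0.
Qed.

Lemma smooth0 : smooth (0 : cfun R).
Proof.
move=> n x; rewrite cderivn0; apply/cvg_ex; exists 0.
rewrite (_ : diff_quotient _ _ = cst 0); first exact: cvg_cst.
by apply/funext => y; rewrite /diff_quotient !fctE subrr scaler0.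
Qed.

Lemma normc_ge0 (z : R[i]) : 0 <= Normc.normc z.
Proof. by rewrite -lecR; exact: (@normr_ge0 _ R[i]). Qed.

Let zero_unit_interval : (0 : R) \in (`[0, 1]%classic : set R).
Proof. by rewrite inE /= in_itv/= lexx ler01. Qed.

Let o : unit_interval R := exist _ 0 zero_unit_interval.

Lemma supnorm_ge f x : ((Normc.normc (f x))%:E <= supnorm f)%E.
Proof. by apply: ereal_sup_ubound; exists x. Qed.

Lemma supnorm_ge0 f : (0 <= supnorm f)%E.
Proof.
by apply: le_trans (supnorm_ge f o); rewrite lee_fin normc_ge0.
Qed.

Lemma supnormD f g : (supnorm (f + g)%R <= supnorm f + supnorm g)%E.
Proof.
apply: ge_ereal_sup => _ [x _ <-].
apply: le_trans (leeD (supnorm_ge f x) (supnorm_ge g x)).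
by rewrite -EFinD lee_fin le_normcD.
Qed.

Lemma supnormZ a f : supnorm (a *: f) = ((Normc.normc a)%:E * supnorm f)%E.
Proof.
rewrite /supnorm -ereal_supZl ?normc_ge0//; last first.
  by apply/set0P; exists (Normc.normc (f o))%:E; exists o.
congr ereal_sup; rewrite image_comp; apply: eq_imagel => x _ /=.
by rewrite -EFinM -Normc.normcM.
Qed.

Variable M : weight_seq R.

Lemma Dterm_ge0 f n : (0 <= supnorm (cderivn n f) * ((M n)^-1)%:E)%E.
Proof.
by rewrite mule_ge0 ?supnorm_ge0// lee_fin invr_ge0 ltW// weight_gt0.
Qed.

Lemma Dnorm_ge0 f : (0 <= Dnorm M f)%E.
Proof. by apply: nneseries_ge0 => n _ _; exact: Dterm_ge0. Qed.

Lemma Dnorm0 : Dnorm M 0 = 0%E.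
Proof.
rewrite /Dnorm eseries0// => n _ _; rewrite cderivn0 -(scaler0 _ 0) supnormZ.
by rewrite Normc.normc0 !mul0e.
Qed.

Lemma DnormD f g : smooth f -> smooth g ->
  (Dnorm M (f + g)%R <= Dnorm M f + Dnorm M g)%E.
Proof.
move=> sf sg; rewrite /Dnorm -nneseriesD; do ?by move=> *; exact: Dterm_ge0.
apply: lee_nneseries => [*|n _]; first exact: Dterm_ge0.
have -> : cderivn n (f + g) = cderivn n f + cderivn n g.
  by rewrite -[f in LHS]scale1r cderivn_linear// scale1r.
rewrite -ge0_muleDl ?supnorm_ge0//; apply: lee_wpmul2r; last exact: supnormD.
by rewrite lee_fin invr_ge0 ltW// weight_gt0.
Qed.

Lemma DnormZ a f : smooth f ->
  Dnorm M (a *: f) = ((Normc.normc a)%:E * Dnorm M f)%E.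
Proof.
move=> sf; rewrite /Dnorm -nneseriesZl; last by move=> *; exact: Dterm_ge0.
apply: eq_eseriesr => n _.
have -> : cderivn n (a *: f) = a *: cderivn n f.
  have := cderivn_linear a n sf smooth0.
  by rewrite addr0 cderivn0 addr0.
by rewrite supnormZ muleA.
Qed.

Lemma Dnorm_eq0 f : Dnorm M f = 0%E -> f = 0.
Proof.
move=> f0; apply/funext => x; apply: Normc.eq0_normc; apply/eqP.
rewrite eq_le normc_ge0 andbT -lee_fin; apply: le_trans (supnorm_ge f x) _.
apply: (@le_trans _ _ (Dnorm M f)); last by rewrite f0.
have := @nneseries_lim_ge R _ xpredT 0%N 1%N
  (fun n _ _ => Dterm_ge0 f n).
by rewrite big_nat1 weight0 invr1 mule1.
Qed.

Lemma in_DP f : reflect (smooth f /\ (Dnorm M f < +oo)%E) (f \in in_D M).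
Proof. exact: asboolP. Qed.

Lemma in_D_submod_closed : submod_closed (in_D M).
Proof.
split=> [|a f g].
  by apply/in_DP; split; [exact: smooth0|rewrite Dnorm0; exact: ltry].
move=> /in_DP[sf foo] /in_DP[sg goo]; apply/in_DP.
have saf : smooth (a *: f).
  by have := smooth_linear (a := a) sf smooth0; rewrite addr0.
split; first exact: smooth_linear.
apply: le_lt_trans (DnormD saf sg) _; rewrite lte_add_pinfty//.
by rewrite (DnormZ a sf) lte_mul_pinfty// lee_fin normc_ge0.
Qed.

End D_algebra.

#[global] Hint Extern 0 (ProperFilter _^') =>
  solve [apply: dnbhs_unit_interval_proper] : typeclass_instances.

Record Dfun (R : realType) (M : weight_seq R) :=
  DFun { dfun :> cfun R ; dfunP : dfun \in in_D M }.

HB.instance Definition _ (R : realType) (M : weight_seq R) :=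
  [isSub for @dfun R M].
HB.instance Definition _ (R : realType) (M : weight_seq R) :=
  [Choice of Dfun M by <:].

Section Dfun_normed.
Context {R : realType} (M : weight_seq R).
Implicit Types f g : Dfun M.

HB.instance Definition _ :=
  GRing.isSubmodClosed.Build _ _ (in_D M) (in_D_submod_closed M).
HB.instance Definition _ := [SubChoice_isSubLmodule of Dfun M by <:].

(* The library takes norms in the scalar field, hence the embedding in R[i]. *)
Definition Dfun_norm f : R[i] := (fine (Dnorm M f))%:C.

Let Dfun_smooth f : smooth f.
Proof. by case: f => f /= /in_DP[]. Qed.

Let Dfun_fin f : Dnorm M f \is a fin_num.
Proof.
by rewrite ge0_fin_numE ?Dnorm_ge0//; case: f => f /= /in_DP[].
Qed.

Let Dfun_normD f g : Dfun_norm (f + g) <= Dfun_norm f + Dfun_norm g.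
Proof.
rewrite /Dfun_norm -rmorphD/= lecR -fineD//.
apply: fine_le; first exact: (Dfun_fin (f + g)).
  by rewrite fin_numD !Dfun_fin.
exact: (DnormD M (@Dfun_smooth f) (@Dfun_smooth g)).
Qed.

Let Dfun_normZ (a : R[i]) f : Dfun_norm (a *: f) = `|a| * Dfun_norm f.
Proof.
have -> : Dfun_norm (a *: f) = (fine (Dnorm M (a *: (f : cfun R))))%:C by [].
by rewrite (DnormZ M a (@Dfun_smooth f)) fineM// rmorphM.
Qed.

Let Dfun_norm_eq0 f : Dfun_norm f = 0 -> f = 0.
Proof.
move=> [f0]; have h : Dnorm M f = 0%E by rewrite -(fineK (Dfun_fin f)) f0.
by apply: val_inj; exact: Dnorm_eq0 h.
Qed.

HB.instance Definition _ :=
  Lmodule_isNormed.Build R[i] (Dfun M) Dfun_normD Dfun_normZ Dfun_norm_eq0.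

End Dfun_normed.

(* precompact means that the closure is compact *)
Definition compact_operator (K : numFieldType) (V W : normedModType K)
    (T : V -> W) :=
  forall A : set V, bounded_set A -> precompact (T @` A).

(* The complement is the set of l such that T - l has a bounded two-sided
   inverse; for linear maps continuity is boundedness. *)
Definition spectrum (K : numFieldType) (V : normedModType K)
    (T : {linear V -> V}) : set K :=
  [set l | ~ exists S : {linear V -> V}, [/\ continuous S,
      forall v, S (T v - l *: v) = v & forall v, T (S v) - l *: S v = v]].

Section endo.
Context {R : realType} (M : weight_seq R).
Definition induces_endo (phi : unit_interval R -> unit_interval R) :=
  forall f : cfun R, f \in in_D M -> f \o phi \in in_D M.

Definition endo phi (H : induces_endo phi) (f : Dfun M) : Dfun M :=
  DFun (H _ (dfunP f)).

Lemma endo_linear phi (H : induces_endo phi) : linear (endo H).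
Proof. by move=> a f g; apply: val_inj. Qed.
HB.instance Definition _ phi (H : induces_endo phi) :=
  GRing.isLinear.Build R[i] (Dfun M) (Dfun M) _ (endo H) (endo_linear H).

End endo.

(* Main.v *)
Require Import Defs.
From HB Require Import structures.
From mathcomp Require Import all_boot all_order all_algebra complex.
From mathcomp Require Import all_classical all_reals all_analysis.
From mathcomp Require Import ring lra.

(* Let T f = f o phi, a = phi'(x0), and let phi^n be the n-th iterate.  By
   compactness, for every eta > 0 there is C with
     ||T f|| <= eta ||f|| + C ||f||_oo,
   and since T does not increase the uniform norm this iterates to
   ||T^n f|| <= 2^-n ||f|| + C ||f||_oo.  Applied to polynomials that have slope 1
   at phi^n(x) but a small uniform norm, it shows that (phi^n)' -> 0 uniformly,
   so that phi^n -> x0 geometrically fast.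

   Let J_k be the space of f in D with f(y) = O(|y - x0|^k).  Taylor expansion
   gives (T - a^k) J_k <= J_(k+1).  If l is neither 0 nor a power of a, then
   T - l is therefore bijective as soon as it is so on some J_k; and for large k
   the uniform norms of T^n f, hence by the inequality above the norms ||T^n f||,
   are O((|l|/2)^n) on J_k.  Thus T - l is injective, and the Neumann series
   solves T f - l f = g on J_k: its partial sums are bounded and T is compact, so
   completeness of D is not needed.  Compactness also bounds the inverse.

   Conversely, if l = a^n is nonzero with n minimal, then T f - l f = (x - x0)^n
   would force f in J_n and (x - x0)^n in J_(n+1).  Finally, an inverse of T would
   give ||f|| <= C ||f||_oo, which the same polynomials of slope 1 refute. *)

Set Implicit Arguments.
Unset Strict Implicit.
Unset Printing Implicit Defensive.

Import Order.TTheory GRing.Theory Num.Theory.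
Import numFieldNormedType.Exports.

Local Open Scope classical_set_scope.
Local Open Scope ring_scope.
Local Open Scope complex_scope.

Local Notation normc z := (Normc.normc (z : _[i])).

(** * The real-valued modulus of complex numbers *)

Section normc_theory.
Context {R : realType}.
Implicit Types (z w : R[i]) (r : R).

Lemma normrE_normc z : `|z| = (normc z)%:C.
Proof. by []. Qed.

Lemma normc_real r : normc r%:C = `|r|.
Proof. by rewrite /Normc.normc /= expr0n /= addr0 sqrtr_sqr. Qed.

Lemma normcX z n : normc (z ^+ n) = normc z ^+ n.
Proof.
by elim: n => [|n IHn]; rewrite ?expr0 ?Normc.normc1// !exprS Normc.normcM IHn.
Qed.

Lemma normc_distC z w : normc (z - w) = normc (w - z).
Proof. by rewrite -normcN opprB. Qed.

Lemma normc_gt0 z : z != 0 -> 0 < normc z.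
Proof.
move=> z0; rewrite lt_neqAle normc_ge0 andbT eq_sym.
by apply: contra z0 => /eqP/Normc.eq0_normc ->.
Qed.

End normc_theory.

(** * Derivatives on [0,1], the chain rule and the mean value inequality *)

Section derivative.
Context {R : realType}.
Local Notation I := (unit_interval R).
Implicit Types (f g : cfun R) (x y z : I) (l m : R[i]).

Lemma unit_interval_itv x : 0 <= \val x <= 1.
Proof. by have /set_mem := valP x; rewrite /= in_itv. Qed.

Lemma unit_interval_ex (t : R) : 0 <= t <= 1 -> exists x, \val x = t.
Proof.
move=> t01; have tI : t \in `[0, 1]%classic by rewrite inE /= in_itv.
by exists (exist _ t tI).
Qed.

Lemma unit_interval0 : exists x, \val x = 0.
Proof. by apply: unit_interval_ex; rewrite lexx ler01. Qed.

Lemma dist_le1 x y : `|\val x - \val y| <= 1.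
Proof.
have /andP[x0 x1] := unit_interval_itv x; have /andP[y0 y1] := unit_interval_itv y.
by rewrite ler_norml; lra.
Qed.

Definition is_cderiv f x l := forall e, 0 < e -> exists2 d : R, 0 < d &
  forall y, `|\val y - \val x| < d ->
    normc (f y - f x - (\val y - \val x)%:C * l) <= e * `|\val y - \val x|.

Lemma dnbhs_unit_intervalP x (P : set I) : x^' P <-> exists2 d : R, 0 < d &
  forall y, y != x -> `|\val y - \val x| < d -> P y.
Proof.
rewrite /dnbhs /within/=; split.
  move=> /nbhs_ballP[d /= d0 xP]; exists d => // y yx ydx; apply: xP => //.
  by rewrite -initial_ballE/= /ball/= set_valE/= distrC.
move=> [d d0 dP]; apply/nbhs_ballP; exists d => //= y.
rewrite -initial_ballE/= /ball/= set_valE/= distrC => ydx yx.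
exact: dP.
Qed.

Lemma is_cderivP f x l : diff_quotient f x @ x^' --> (l : R[i]^o) <->
  is_cderiv f x l.
Proof.
have key y : y != x ->
    normc (f y - f x - (\val y - \val x)%:C * l) =
    normc (l - diff_quotient f x y) * `|\val y - \val x|.
  move=> yx; have t0 : (\val y - \val x)%:C != 0.
    rewrite -(rmorph0 (real_complex R)) (inj_eq (@complexI _)) subr_eq0.
    by apply: contra yx => /eqP/val_inj ->.
  rewrite normc_distC -normc_real -Normc.normcM; congr Normc.normc.
  rewrite /diff_quotient /= /GRing.scale /= mulrBl mulrC; congr (_ - _).
  by rewrite mulrAC mulVf// mul1r.
split=> [/cvgrPdist_le fl e e0|fl].
  have /fl/dnbhs_unit_intervalP[d d0 dP] : 0 < e%:C by rewrite ltcR.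
  exists d => // y yd; have [->|yx] := eqVneq y x.
    by rewrite !subrr mul0r subrr Normc.normc0 normr0 mulr0.
  rewrite key// ler_wpM2r//.
  by have := dP y yx yd; rewrite /= normrE_normc lecR.
apply/cvgrPdist_le => e e0.
have er : e = (complex.Re e)%:C by rewrite RRe_real// gtr0_real.
have re0 : 0 < complex.Re e by rewrite -ltcR -er.
have [d d0 dP] := fl _ re0.
apply/dnbhs_unit_intervalP; exists d => // y yx yd.
have := dP y yd; rewrite key// ler_pM2r => [h|]; last first.
  rewrite normr_gt0 subr_eq0; apply: contra yx => /eqP h.
  by apply/eqP/val_inj.
by rewrite normrE_normc er lecR.
Qed.

Lemma cderivable_is_cderiv f x : cderivable f x -> is_cderiv f x (cderiv f x).
Proof. by move=> fx; apply/is_cderivP. Qed.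

Lemma is_cderiv_cderivable f x l : is_cderiv f x l -> cderivable f x.
Proof. by move=> /is_cderivP fl; apply/cvg_ex; exists l. Qed.

Lemma is_cderiv_cderiv f x l : is_cderiv f x l -> cderiv f x = l.
Proof. by move=> /is_cderivP; apply: cvg_lim; exact: norm_hausdorff. Qed.

Lemma is_cderiv_lipschitz f x l B : is_cderiv f x l -> normc l < B ->
  exists2 d : R, 0 < d & forall y, `|\val y - \val x| < d ->
    normc (f y - f x) <= B * `|\val y - \val x|.
Proof.
move=> fl lB; have e0 : 0 < B - normc l by rewrite subr_gt0.
have [d d0 dP] := fl _ e0; exists d => // y /dP h.
rewrite -[f y - f x](subrK ((\val y - \val x)%:C * l)).
rewrite (le_trans (le_normcD _ _))// (le_trans (lerD h (lexx _)))//.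
by rewrite Normc.normcM normc_real mulrBl mulrC [normc l * _]mulrC subrK mulrC.
Qed.

Lemma is_cderiv_comp f (psi : I -> I) x l m :
  is_cderiv f (psi x) l -> is_cderiv (fun y => (\val (psi y))%:C) x m ->
  is_cderiv (f \o psi) x (m * l).
Proof.
move=> fl pm e e0.
pose B := normc m + 1; have B0 : 0 < B by rewrite ltr_wpDl// normc_ge0.
have mB : normc m < B by rewrite ltrDl.
pose L := normc l + 1; have L0 : 0 < L by rewrite ltr_wpDl// normc_ge0.
have [d1 d10 d1P] := is_cderiv_lipschitz pm mB.
have e1 : 0 < e / 2 / B by rewrite !divr_gt0.
have e2 : 0 < e / 2 / L by rewrite !divr_gt0.
have [d2 d20 d2P] := fl _ e1; have [d3 d30 d3P] := pm _ e2.
(* Below [d1], [psi] expands distances to [x] by at most [B], so [d2 / B] keeps [psi y] within [d2]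
   of [psi x]. *)
exists (Num.min (Num.min d1 (d2 / B)) d3).
  by rewrite !lt_min d10 d30 divr_gt0.
move=> y; rewrite !lt_min => /andP[/andP[yd1 yd2] yd3].
have := d1P y yd1; rewrite -rmorphB normc_real => h1.
have pd2 : `|\val (psi y) - \val (psi x)| < d2.
  by rewrite (le_lt_trans h1)// mulrC -ltr_pdivlMr.
have := d2P _ pd2 => h2; have := d3P _ yd3; rewrite -rmorphB => h3.
set t := \val y - \val x in h1 h3 *; set s := \val (psi y) - _ in h1 h2 h3.
(* The error splits into that of [f] at [psi x] and [l] times that of [psi] at [x]; each receives
   [e / 2]. *)
have -> : (f \o psi) y - (f \o psi) x - t%:C * (m * l) =
    (f (psi y) - f (psi x) - s%:C * l) + (s%:C - t%:C * m) * l :> R[i].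
  by rewrite /=; ring.
rewrite (le_trans (le_normcD _ _))// Normc.normcM.
rewrite [e]splitr mulrDl lerD//.
  rewrite (le_trans h2)// (le_trans (ler_wpM2l (ltW e1) h1))//.
  by rewrite mulrA divfK// gt_eqF.
rewrite (le_trans (ler_wpM2r (normc_ge0 l) h3))// mulrAC ler_wpM2r//.
by rewrite -[leRHS](@divfK _ L) ?gt_eqF// ler_wpM2l ?(ltW e2)// /L lerDl.
Qed.

(* The supremum of the t for which the bound with B + e holds on [x, t] is
   shown to be y, which avoids splitting into real and imaginary parts. *)
Lemma mean_value_le f x y B : 0 <= B -> \val x <= \val y ->
  (forall z, cderivable f z) ->
  (forall z, \val x <= \val z <= \val y -> normc (cderiv f z) <= B) ->
  normc (f y - f x) <= B * (\val y - \val x).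
Proof.
move=> B0 xy fd fB; apply/ler_addgt0Pr => e0 e00.
pose e := e0 / 2; have e_gt0 : 0 < e by rewrite divr_gt0.
suff : normc (f y - f x) <= (B + e) * (\val y - \val x).
  move=> h; rewrite (le_trans h)// mulrDl lerD2l.
  have yx1 : \val y - \val x <= 1 by rewrite (le_trans (ler_norm _))// dist_le1.
  by rewrite (le_trans (ler_wpM2l (ltW e_gt0) yx1))// mulr1 /e; lra.
have loc z : \val x <= \val z <= \val y -> exists2 d : R, 0 < d &
    forall w, `|\val w - \val z| < d ->
      normc (f w - f z) <= (B + e) * `|\val w - \val z|.
  move=> /fB zB; apply: is_cderiv_lipschitz (cderivable_is_cderiv (fd z)) _.
  by rewrite (le_lt_trans zB)// ltrDl.
pose S := [set t : R | exists2 z, \val z = t & \val x <= t <= \val y /\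
  normc (f z - f x) <= (B + e) * (t - \val x)].
have Sx : S (\val x).
  by exists x => //; rewrite lexx xy !subrr Normc.normc0 mulr0.
have Sub : ubound S (\val y) by move=> t [z _ [/andP[]]].
have hS : has_sup S by split; [exists (\val x)|exists (\val y)].
have xs : \val x <= sup S by apply: ub_le_sup => //; exact: hS.2.
have sy : sup S <= \val y by apply: ge_sup => //; exists (\val x).
have [s sE] : exists s : I, \val s = sup S.
  apply: unit_interval_ex; have /andP[x0 _] := unit_interval_itv x.
  by have /andP[_ y1] := unit_interval_itv y; rewrite (le_trans x0)//= (le_trans sy).
have xsy : \val x <= \val s <= \val y by rewrite sE xs sy.
have [d d0 dP] := loc s xsy.
(* The supremum belongs to [S]: chain the bound at a point of [S] within [d] below [s] with the
   local bound at [s]. *)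
have Ss : normc (f s - f x) <= (B + e) * (\val s - \val x).
  have [_ [z <- [/andP[xz zy] zB]] sdz] := sup_adherent d0 hS.
  have zs : \val z <= \val s.
    rewrite sE; apply: ub_le_sup; first exact: hS.2.
    by exists z => //; rewrite xz zy.
  have zd : `|\val z - \val s| < d.
    by rewrite distrC ger0_norm ?subr_ge0// ltrBlDr -ltrBlDl sE.
  have -> : f s - f x = (f s - f z) + (f z - f x) by rewrite addrA subrK.
  rewrite (le_trans (le_normcD _ _))//.
  have := dP z zd; rewrite normc_distC distrC ger0_norm ?subr_ge0// => h.
  by rewrite (le_trans (lerD h zB))// -mulrDr addrA subrK.
suff -> : y = s by [].
apply: val_inj => /=; apply/eqP; rewrite eq_le -{1}sE in sy *.
rewrite sy andbT leNgt; apply/negP => sly.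
(* If [s] were left of [y], the local bound at [s] would put this larger [t] into [S]. *)
pose t := Num.min (\val y) (\val s + d / 2).
have st : \val s < t by rewrite lt_min sly ltrDl divr_gt0.
have ty : t <= \val y by rewrite ge_min lexx.
have [w wE] : exists w : I, \val w = t.
  apply: unit_interval_ex; have /andP[s0 _] := unit_interval_itv s.
  by have /andP[_ y1] := unit_interval_itv y;
    rewrite (le_trans s0 (ltW st))//= (le_trans ty).
have : t <= sup S.
  apply: ub_le_sup; first exact: hS.2.
  exists w => //; rewrite ty (le_trans _ (ltW st)) ?sE//; split=> //.
  have wd : `|\val w - \val s| < d.
    rewrite wE gtr0_norm ?subr_gt0// ltrBlDl (@le_lt_trans _ _ (\val s + d / 2))//.
      by rewrite ge_min lexx orbT.
    by rewrite ltrD2l ltr_pdivrMr// ltr_pMr// ltr1n.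
  have -> : f w - f x = (f w - f s) + (f s - f x) by rewrite addrA subrK.
  rewrite (le_trans (le_normcD _ _))//.
  have := dP w wd; rewrite wE gtr0_norm ?subr_gt0// => h.
  by rewrite (le_trans (lerD h Ss))// -mulrDr addrA subrK.
by rewrite -sE leNgt st.
Qed.

(** The derivative is only bounded at points no farther from [x] than [y], so that [B] may depend on
    this distance, as in [flat_of_cderivn]. *)
Lemma mean_value_norm f x y B : 0 <= B -> (forall z, cderivable f z) ->
  (forall z, `|\val z - \val x| <= `|\val y - \val x| ->
    normc (cderiv f z) <= B) ->
  normc (f y - f x) <= B * `|\val y - \val x|.
Proof.
move=> B0 fd fB; have [xy|/ltW yx] := leP (\val x) (\val y).
  rewrite ger0_norm ?subr_ge0//; apply: mean_value_le => // z /andP[xz zy].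
  by apply: fB; rewrite !ger0_norm ?subr_ge0// lerB.
rewrite normc_distC distrC ger0_norm ?subr_ge0//.
apply: mean_value_le => // z /andP[yz zx].
by apply: fB; rewrite distrC [leRHS]distrC !ger0_norm ?subr_ge0// lerB.
Qed.

End derivative.

Arguments unit_interval0 : clear implicits.

(** * The norm of D as a real number, and the bounds it gives *)

Section Dnorm_theory.
Context {R : realType} {M : weight_seq R}.
Local Notation I := (unit_interval R).
Implicit Types (f g : Dfun M) (x y z : I).

Lemma Dfun_smooth f : smooth f.
Proof. by case: f => f /= /in_DP[]. Qed.

Lemma Dfun_fin f : Dnorm M f \is a fin_num.
Proof. by rewrite ge0_fin_numE ?Dnorm_ge0//; case: f => f /= /in_DP[]. Qed.

Definition Dn f : R := fine (Dnorm M f).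

Lemma DnE f : `|f| = (Dn f)%:C.
Proof. by []. Qed.

Lemma Dn_ge0 f : 0 <= Dn f.
Proof. by rewrite -lecR -DnE normr_ge0. Qed.

Lemma DnD f g : Dn (f + g) <= Dn f + Dn g.
Proof. by rewrite -lecR rmorphD -!DnE ler_normD. Qed.

Lemma DnZ (a : R[i]) f : Dn (a *: f) = normc a * Dn f.
Proof. by apply: complexI; rewrite rmorphM -!DnE normrZ normrE_normc. Qed.

Lemma DnN f : Dn (- f) = Dn f.
Proof. by apply: complexI; rewrite -!DnE normrN. Qed.

Lemma DnB f g : Dn (f - g) <= Dn f + Dn g.
Proof. by rewrite (le_trans (DnD _ _))// DnN. Qed.

Lemma Dn0 : Dn 0 = 0.
Proof. by apply: complexI; rewrite -DnE normr0. Qed.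

Lemma Dn_eq0 f : Dn f = 0 -> f = 0.
Proof. by move=> f0; apply/normr0_eq0; rewrite DnE f0. Qed.

(** One term of a series of non-negative terms is at most its sum. *)
Lemma cderivn_le f n y : normc (cderivn n f y) <= M n * Dn f.
Proof.
rewrite mulrC -ler_pdivrMr ?weight_gt0// -lee_fin /Dn fineK ?Dfun_fin//.
rewrite EFinM; apply: (@le_trans _ _ (supnorm (cderivn n f) * ((M n)^-1)%:E)%E).
  by rewrite lee_wpmul2r ?supnorm_ge// lee_fin invr_ge0 ltW// weight_gt0.
have := @nneseries_lim_ge R (fun n => supnorm (cderivn n f) * ((M n)^-1)%:E)%E
  xpredT 0%N n.+1 (fun n _ _ => Dterm_ge0 M f n).
apply: le_trans; rewrite big_nat_recr//= leeDr//.
by rewrite sume_ge0// => i _; exact: Dterm_ge0.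
Qed.

Lemma Dfun_le f y : normc (f y) <= Dn f.
Proof. by have := cderivn_le f 0 y; rewrite weight0 mul1r. Qed.

(** Stated for arbitrary functions, since it serves to show that polynomials belong to [in_D]. *)
Lemma Dnorm_le (h : cfun R) (c : nat -> R) N :
  (forall n y, normc (cderivn n h y) <= c n) ->
  (forall n, (N <= n)%N -> c n = 0) ->
  (Dnorm M h <= (\sum_(0 <= n < N) c n / M n)%:E)%E.
Proof.
move=> hc c0; apply: lime_le.
  by apply: is_cvg_nneseries => n _ _; exact: Dterm_ge0.
near=> k; have Nk : (N <= k)%N by near: k; exists N.
rewrite -sumEFin; apply: (@le_trans _ _ (\sum_(0 <= n < k) (c n / M n)%:E)%E).
  apply: lee_sum => n _; rewrite EFinM lee_wpmul2r//.
    by rewrite lee_fin invr_ge0 ltW// weight_gt0.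
  by apply: ge_ereal_sup => _ [y _ <-]; rewrite lee_fin.
rewrite (big_cat_nat (n := N))//= [X in (_ + X)%E]big1_seq ?adde0//.
by move=> n; rewrite mem_index_iota => /andP[_ /andP[/c0-> _]]; rewrite mul0r.
Unshelve. all: by end_near. Qed.

End Dnorm_theory.

Arguments Dfun_smooth {R M} f n x.

(** * Polynomials as elements of D, with bounds uniform in the centre *)

Section polynomials.
Context {R : realType}.
Local Notation I := (unit_interval R).
Implicit Types (p : {poly R[i]}) (x y z : I).

(** The centre [z] lets one [p] serve at every base point, and differentiation acts on [p] alone. *)
Definition pol p z : cfun R := fun y => p.[(\val y - \val z)%:C].

Lemma pol0 z : pol 0 z = 0.
Proof. by apply/funext => y; rewrite /pol horner0. Qed.

(** The Horner step for differentiating polynomials by induction. *)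
Lemma is_cderiv_mulX (f : cfun R) x z (l c : R[i]) : is_cderiv f x l ->
  is_cderiv (fun y => f y * (\val y - \val z)%:C + c) x
    (l * (\val x - \val z)%:C + f x).
Proof.
move=> fl e e0.
pose B := normc l + 1; have B0 : 0 < B by rewrite ltr_wpDl// normc_ge0.
have lB : normc l < B by rewrite ltrDl.
have [d1 d10 d1P] := is_cderiv_lipschitz fl lB.
have e2 : 0 < e / 2 by rewrite divr_gt0.
have [d2 d20 d2P] := fl _ e2.
exists (Num.min (Num.min d1 d2) (e / 2 / B)).
  by rewrite !lt_min d10 d20 divr_gt0.
move=> y; rewrite !lt_min => /andP[/andP[yd1 yd2] yd3].
have := d1P y yd1; have := d2P y yd2 => h2 h1.
set t := \val y - \val x in h1 h2 yd3 *.
have yE : \val y - \val z = t + (\val x - \val z) by rewrite /t; ring.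
rewrite yE rmorphD /=.
set s := (\val x - \val z)%:C.
have -> : f y * (t%:C + s) + c - (f x * s + c) - t%:C * (l * s + f x) =
  (f y - f x - t%:C * l) * s + (f y - f x) * t%:C :> R[i] by ring.
rewrite (le_trans (le_normcD _ _))// !Normc.normcM !normc_real.
rewrite [e]splitr mulrDl lerD//.
  by rewrite -[leRHS]mulr1 ler_pM ?normc_ge0// dist_le1.
rewrite ler_wpM2r// (le_trans h1)// mulrC -ler_pdivlMr//.
exact: ltW.
Qed.

Lemma is_cderiv_pol p z x : is_cderiv (pol p z) x (pol p^`() z x).
Proof.
rewrite /pol; elim/poly_ind: p => [|p c IHp].
  rewrite deriv0 horner0 => e e0; exists 1 => // y _.
  by rewrite !horner0 mulr0 !subrr Normc.normc0 mulr_ge0// ltW.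
have := is_cderiv_mulX z c IHp.
rewrite derivMXaddC hornerD hornerM hornerX addrC.
suff -> : (fun y => (p * 'X + c%:P).[(\val y - \val z)%:C]) =
  (fun y => p.[(\val y - \val z)%:C] * (\val y - \val z)%:C + c) by [].
by apply/funext => y; rewrite hornerMXaddC.
Qed.

Lemma cderivn_pol p z n : cderivn n (pol p z) = pol p^`(n) z.
Proof.
elim: n => [//|n IHn]; rewrite /cderivn iterS -/(cderivn n _) IHn derivnS.
by apply/funext => x; apply: is_cderiv_cderiv; exact: is_cderiv_pol.
Qed.

Lemma smooth_pol p z : smooth (pol p z).
Proof.
move=> n x; rewrite cderivn_pol; apply: is_cderiv_cderivable.
exact: is_cderiv_pol.
Qed.

(** Bounds [p] on [-1,1], where differences of points of [0,1] lie; hence [pol_bound] does not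
    involve the centre. *)
Definition coef_sum p : R := \sum_(i < size p) normc p`_i.

Lemma pol_le p z y : normc (pol p z y) <= coef_sum p.
Proof.
rewrite /pol horner_coef /coef_sum; elim/big_rec2 : _ => [|i u v _ uv].
  by rewrite Normc.normc0.
rewrite (le_trans (le_normcD _ _))// lerD// Normc.normcM normcX normc_real.
by rewrite -[leRHS]mulr1 ler_wpM2l ?normc_ge0// exprn_ile1// dist_le1.
Qed.

Variable M : weight_seq R.

Definition pol_bound p : R :=
  \sum_(0 <= n < size p) coef_sum p^`(n) / M n.

Lemma Dnorm_pol_le p z : (Dnorm M (pol p z) <= (pol_bound p)%:E)%E.
Proof.
apply: Dnorm_le => [n y|n pn]; first by rewrite cderivn_pol; exact: pol_le.
by rewrite derivn_poly0// /coef_sum size_poly0 big_ord0.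
Qed.

Lemma pol_in_D p z : pol p z \in in_D M.
Proof.
apply/in_DP; split; first exact: smooth_pol.
exact: le_lt_trans (Dnorm_pol_le p z) (ltry _).
Qed.

Definition Dpol p z : Dfun M := DFun (pol_in_D p z).

Lemma Dn_pol_le p z : Dn (Dpol p z) <= pol_bound p.
Proof. by rewrite -lee_fin /Dn fineK ?Dfun_fin//; exact: Dnorm_pol_le. Qed.

End polynomials.

Lemma subr_subl {V : zmodType} (a b c : V) : a - b - (a - c) = c - b.
Proof. by rewrite opprB addrC subrKA. Qed.

Lemma exprn_le_ex {R : realType} (q e : R) : 0 <= q < 1 -> 0 < e ->
  exists n, q ^+ n <= e.
Proof.
move=> /andP[q0 q1] e0; have qN : `|q| < 1 by rewrite ger0_norm.
have /cvgrPdist_le/(_ e e0)[n _ /(_ n (leqnn n))/=] := cvg_expr qN.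
by rewrite sub0r normrN ger0_norm ?exprn_ge0// => h; exists n.
Qed.

(** Take X(1 - X^2)^N: at t in [-1,1] it is at most |t|, which settles |t| <= e, and for |t| > e it
    is at most (1 - e^2)^N, which is below e for large N. *)
Lemma spike_ex {R : realType} (e : R) : 0 < e -> exists p : {poly R[i]},
  p^`().[0] = 1 /\ forall z y, normc (pol p z y) <= e.
Proof.
move=> e0; wlog e1 : e e0 / e < 1 => [hwlog|].
  have [e1|e1] := ltP e 1; first exact: hwlog.
  have [||p [p0 pe]] := hwlog (1 / 2); [lra|lra|].
  by exists p; split => // z y; rewrite (le_trans (pe z y))//; lra.
have [|N Ne] := @exprn_le_ex R (1 - e ^+ 2) e _ e0; first by apply/andP; nra.
exists ('X * (1 - 'X ^+ 2) ^+ N); split.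
  rewrite derivM derivX mul1r hornerD hornerM hornerX mul0r addr0.
  by rewrite horner_exp hornerD hornerN hornerXn expr0n/= hornerC subr0 expr1n.
move=> z y; rewrite /pol; have := dist_le1 y z.
move: (_ - _) => t t1.
rewrite hornerM hornerX horner_exp hornerD hornerN hornerXn hornerC.
have -> : t%:C * (1 - t%:C ^+ 2) ^+ N = (t * (1 - t ^+ 2) ^+ N)%:C.
  by rewrite rmorphM rmorphXn rmorphB rmorph1 rmorphXn.
rewrite normc_real normrM.
have t2 : 0 <= 1 - t ^+ 2 <= 1.
  by rewrite -real_normK ?num_real//; have := normr_ge0 t; move=> ?;
    apply/andP; nra.
have /andP[u0 u1] := t2.
rewrite [X in _ * X]ger0_norm ?exprn_ge0//.
have [te|et] := leP `|t| e.
  by rewrite -[leRHS]mulr1 ler_pM ?exprn_ge0// exprn_ile1.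
rewrite -[leRHS]mul1r ler_pM ?exprn_ge0// (le_trans _ Ne)//.
rewrite lerXn2r ?nnegrE//; first by nra.
by rewrite lerD2l lerN2 -[leRHS]real_normK ?num_real// lerXn2r ?nnegrE ?normr_ge0 ?(ltW e0) ?(ltW et).
Qed.

(** * Compactness of T, and geometric convergence of the iterates of [phi] *)

Section compact_endomorphism.
Context {R : realType} {M : weight_seq R}.
Local Notation I := (unit_interval R).
Variables (phi : I -> I) (phiM : induces_endo M phi).
Implicit Types (f g h : Dfun M) (x y z : I).
Local Notation T := (endo phiM).

Lemma endoE f y : T f y = f (phi y).
Proof. by []. Qed.

Lemma iter_endoE n f y : iter n T f y = f (iter n phi y).
Proof. by elim: n y => [//|n IHn] y; rewrite [in RHS]iterSr -IHn. Qed.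

Lemma id_in_D : exists f, forall y, f y = (\val y)%:C.
Proof.
have [pt ptE] := unit_interval0 R.
by exists (Dpol M 'X pt) => y; rewrite /= /pol ptE subr0 hornerX.
Qed.

Hypothesis cT : compact_operator T.

(** [h] is a cluster point of [T (u n)]; being near it for arbitrarily late [m] replaces a
    convergent subsequence. *)
Lemma compact_operator_seq (u : nat -> Dfun M) b :
  (forall n, Dn (u n) <= b) ->
  exists h, forall e m0, 0 < e -> exists2 m, (m0 <= m)%N & Dn (T (u m) - h) < e.
Proof.
move=> ub; pose A : set (Dfun M) := range u.
have bA : bounded_set A.
  exists b%:C; split; first by rewrite realE !lecR; exact: le_total.
  by move=> r br _ [n _ <-] /=; rewrite (le_trans _ (ltW br))// DnE lecR.
have := cT bA; rewrite precompactE => cA.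
have [|h [_ hcl]] := cA (T \o u @ \oo) _.
  exists 0%N => // n _ /=; apply: subset_closure; exists (u n) => //.
  by exists n.
exists h => e m0 e0.
have [||_ [[m m0m <-] hm]] := hcl [set T (u m) | m in [set m | m0 <= m]%N] (ball h e%:C).
- by exists m0 => // m m0m; exists m.
- by apply: nbhsx_ballx; rewrite ltcR.
exists m => //; move: hm; rewrite -ball_normE/= distrC.
by rewrite DnE ltcR.
Qed.

(* Ehrling's lemma, for the compact operator T and the weaker uniform norm. *)
Lemma compact_ehrling eta : 0 < eta -> exists2 C : R, 0 <= C & forall f s,
  (forall y, normc (f y) <= s) -> Dn (T f) <= eta * Dn f + C * s.
Proof.
move=> eta0.
have [e e0 eP] : exists2 e : R, 0 < e & forall f, Dn f <= 1 ->
    (forall y, normc (f y) <= e) -> Dn (T f) <= eta.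
  apply: contrapT => nex.
  have ex n : exists f, [/\ Dn f <= 1, forall y, normc (f y) <= n.+1%:R^-1 &
      eta < Dn (T f)].
    apply: contrapT => nf; apply: nex; exists n.+1%:R^-1 => // f f1 fn.
    by rewrite leNgt; apply/negP => etaf; apply: nf; exists f.
  have [u uP] := choice ex.
  have [|h hP] := @compact_operator_seq u 1; first by move=> n; case: (uP n).
  (* [T (u m)] tends to 0 uniformly, as [u m] does, and it comes arbitrarily near [h] for late
     [m]. *)
  have h0 : h = 0.
    apply: val_inj; apply/funext => y; apply: Normc.eq0_normc; apply/eqP.
    rewrite eq_le normc_ge0 andbT; apply/ler_addgt0Pr => e e0.
    have e20 : 0 < e / 2 by rewrite divr_gt0.
    have [m0 _ m0P] := near_infty_natSinv_lt (PosNum e20).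
    have [m m0m hm] := hP (e / 2) m0 e20.
    have hy : h y = T (u m) y - (T (u m) - h) y :> R[i].
      by rewrite [(_ - h) y](_ : _ = T (u m) y - h y)// opprB addrC subrK.
    rewrite add0r; change (normc (h y) <= e); rewrite hy.
    rewrite (le_trans (le_normcD _ _))// normcN [leRHS]splitr lerD//.
      have [_ um _] := uP m; rewrite endoE (le_trans (um _))// ltW//.
      exact: m0P.
    by rewrite (le_trans (Dfun_le _ _))// ltW.
  have [m _] := hP eta 0%N eta0; rewrite h0 subr0 => um.
  by have [_ _] := uP m; rewrite ltNge ltW.
exists (eta / e) => [|f s fs]; first by rewrite divr_ge0// ltW.
have [pt _] := unit_interval0 R.
have s0 : 0 <= s by rewrite (le_trans _ (fs pt))// normc_ge0.
(* Divided by [t], [f] has norm at most 1 and uniform norm at most [e], so [eP] applies. *)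
rewrite -mulrA -mulrDr [e^-1 * s]mulrC; set t := Dn f + s / e.
have se0 : 0 <= s / e by rewrite divr_ge0// ltW.
have t0 : 0 <= t by rewrite addr_ge0// Dn_ge0.
move: t0; rewrite le_eqVlt => /predU1P[t0|t0].
  have /Dn_eq0-> : Dn f = 0 by have := Dn_ge0 f; move: t0; rewrite /t; lra.
  by rewrite linear0 Dn0 -t0 mulr0.
have nt : normc (t^-1)%:C = t^-1 by rewrite normc_real ger0_norm// invr_ge0 ltW.
have := eP ((t^-1)%:C *: f); rewrite linearZ/= !DnZ nt => h.
rewrite mulrC -ler_pdivrMl//; apply: h.
  by rewrite mulrC ler_pdivrMr// mul1r /t lerDl.
move=> y; rewrite [X in normc X](_ : _ = (t^-1)%:C * f y)// Normc.normcM nt.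
rewrite mulrC ler_pdivrMr// (le_trans (fs y))// mulrC -ler_pdivrMr//.
by rewrite /t lerDr Dn_ge0.
Qed.

Lemma compact_endo_bounded : exists2 K : R, 0 <= K & forall f, Dn (T f) <= K * Dn f.
Proof.
have [C C0 CP] := compact_ehrling ltr01; exists (1 + C); first by rewrite addr_ge0.
by move=> f; rewrite mulrDl; apply: CP => y; exact: Dfun_le.
Qed.

(** The bound [s] persists for all iterates, so the errors add up to a geometric series; hence the
    factor 2 in front of the constant for [eta = 1 / 2]. *)
Lemma iter_ehrling : exists2 C : R, 0 <= C & forall n f s,
  (forall y, normc (f y) <= s) -> Dn (iter n T f) <= (1 / 2) ^+ n * Dn f + C * s.
Proof.
have [|C C0 CP] := @compact_ehrling (1 / 2); first by lra.
exists (2 * C); first by rewrite mulr_ge0.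
move=> n f s fs; elim: n => [|n IHn].
  have [pt _] := unit_interval0 R.
  have s0 : 0 <= s by rewrite (le_trans _ (fs pt))// normc_ge0.
  by rewrite expr0 mul1r lerDl !mulr_ge0.
have := CP (iter n T f) s; rewrite iterS exprS => h.
apply: le_trans (h _) _ => [y|]; first by rewrite iter_endoE.
by move: IHn; set p := _ ^+ n * _ => ?; rewrite -mulrA -/p; lra.
Qed.

(* Testing the iterated Ehrling inequality on a spike with slope 1 at the point
   phi^n x bounds the derivative of phi^n at x. *)
Lemma iter_contraction : exists n, forall x y,
  `|\val (iter n phi y) - \val (iter n phi x)| <= 1 / 2 * `|\val y - \val x|.
Proof.
have [C C0 CP] := iter_ehrling; have M1 := weight_gt0 M 1.
(* With this height, and [n] chosen below, each of the two terms of [iter_ehrling] contributes at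
   most 1/4 to the derivative. *)
pose e := (4 * M 1%N * (C + 1))^-1.
have e0 : 0 < e by rewrite invr_gt0 !mulr_gt0// ltr_wpDl.
have [p [p1 pe]] := spike_ex e0.
pose b := pol_bound M p + 1.
have b0 : 0 <= pol_bound M p.
  have [pt _] := unit_interval0 R.
  by rewrite (le_trans (Dn_ge0 (Dpol M p pt)))// Dn_pol_le.
have [||n nP] := @exprn_le_ex R (1 / 2) (4 * M 1%N * b)^-1; first by lra.
  by rewrite invr_gt0 !mulr_gt0// ltr_wpDl.
have [j jE] := id_in_D.
have FE : iter n T j = (fun y => (\val (iter n phi y))%:C) :> cfun R.
  by apply/funext => y; rewrite iter_endoE jE.
exists n => x y.
suff h : normc (iter n T j y - iter n T j x) <= 1 / 2 * `|\val y - \val x|.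
  by move: h; rewrite !iter_endoE !jE -rmorphB normc_real.
apply: mean_value_norm => [|z|z _]; [by lra|exact: (Dfun_smooth _ 0 z)|].
have Fz := cderivable_is_cderiv (Dfun_smooth (iter n T j) 0 z).
rewrite /cderivn/= FE in Fz.
have := @is_cderiv_pol R p (iter n phi z) (iter n phi z).
rewrite {2}/pol subrr p1 => pz.
have hE : (pol p (iter n phi z)) \o (iter n phi) =
    iter n T (Dpol M p (iter n phi z)).
  by apply/funext => w; rewrite iter_endoE.
have := is_cderiv_cderiv (is_cderiv_comp pz Fz); rewrite mulr1 -FE => <-.
rewrite hE; apply: le_trans (cderivn_le _ 1 z) _.
have := CP n (Dpol M p (iter n phi z)) e (fun y => pe _ y).
have := Dn_pol_le M p (iter n phi z).
set d := Dn (Dpol _ _ _) => dp; set d' := Dn _ => h.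
have Ce : M 1%N * (C * e) <= 1 / 4.
  rewrite /e; set c := (X in X^-1).
  have c0 : 0 < c by rewrite !mulr_gt0// ltr_wpDl.
  by rewrite !mulrA ler_pdivrMr// /c; lra.
have nd : M 1%N * ((1 / 2) ^+ n * d) <= 1 / 4.
  have d0 : 0 <= d := Dn_ge0 _.
  have db : d <= b by rewrite /b; lra.
  apply: (@le_trans _ _ (M 1%N * ((4 * M 1%N * b)^-1 * b))).
    by rewrite ler_pM2l// ler_pM// exprn_ge0//; lra.
  have b1 : 0 < b by rewrite ltr_wpDl.
  have -> : M 1%N * ((4 * M 1%N * b)^-1 * b) = 1 / 4; last by [].
  by field; rewrite !gt_eqF.
rewrite (le_trans (ler_wpM2l (ltW M1) h))// mulrDr; lra.
Qed.

Variable x0 : I.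
Hypothesis fix_x0 : phi x0 = x0.

Lemma iter_fix n : iter n phi x0 = x0.
Proof. by elim: n => //= n ->. Qed.

Lemma iter_geometric : exists D r : R, [/\ 0 <= D, 0 <= r < 1 &
  forall n y, `|\val (iter n phi y) - \val x0| <= D * r ^+ n].
Proof.
have [n nP] := iter_contraction.
(* For [n = 0] the identity would halve the distance from 0 to 1. *)
have n0 : (0 < n)%N.
  rewrite lt0n; apply/eqP => n0; move: nP; rewrite n0 => nP.
  have [pt ptE] := unit_interval0 R.
  have [|i iE] := @unit_interval_ex R 1; first by rewrite lexx ler01.
  by have := nP pt i; rewrite /= ptE iE subr0 normr1; lra.
(* Bernoulli's inequality gives [1 / 2 <= r ^+ n], so a halving every [n] steps is at least as good
   as a factor [r] per step. *)
pose r := 1 - (2 * n%:R)^-1 : R.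
have nR : 1 <= n%:R :> R by rewrite ler1n.
have r0 : 1 / 2 <= r < 1.
  rewrite /r ltrBlDr ltrDl invr_gt0 mulr_gt0 ?ltr0n// andbT.
  have : (n%:R : R)^-1 <= 1 by rewrite invf_le1 ?ltr0n.
  by rewrite invfM; lra.
have /andP[r12 r1] := r0; have r00 : 0 < r by lra.
have rn : 1 / 2 <= r ^+ n.
  suff h k : 1 - k%:R / (2 * n%:R) <= r ^+ k.
    have := h n; rewrite invfM mulrCA divff ?mulr1 ?gt_eqF ?ltr0n//; lra.
  elim: k => [|k IHk]; first by rewrite mul0r subr0 expr0.
  rewrite exprS; apply: (@le_trans _ _ (r ^+ k - (2 * n%:R)^-1)).
    by rewrite -natr1 mulrDl mul1r opprD addrA lerD2r.
  rewrite mulrBl mul1r lerD2l lerN2 ler_piMr ?invr_ge0 ?mulr_ge0//.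
  exact: (exprn_ile1 k (ltW r00) (ltW r1)).
(* This constant makes the bound trivial for the iterates before the [n]-th, as distances are at
   most 1. *)
exists (r ^+ n)^-1, r; split; [by rewrite invr_ge0 exprn_ge0// ltW|lra|].
elim/ltn_ind => k IHk y; have [kn|nk] := ltnP k n.
  rewrite (le_trans (dist_le1 _ _))// mulrC ler_pdivlMr ?exprn_gt0// mul1r.
  exact: (ler_wiXn2l (ltW r00) (ltW r1) (ltnW kn)).
rewrite -(subnKC nk) iterD -{1}(iter_fix n) (le_trans (nP _ _))//.
have := IHk (k - n)%N; rewrite ltn_subrL n0 (leq_trans n0 nk) => /(_ isT y) h.
have h2 : 0 <= 1 / 2 :> R by lra.
rewrite (le_trans (ler_wpM2l h2 h))//.
rewrite exprD mulKf ?gt_eqF ?exprn_gt0//.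
rewrite mulrA ler_piMl ?exprn_ge0 ?(ltW r00)//.
by rewrite ler_pdivrMr ?exprn_gt0// [leRHS]mul1r.
Qed.

End compact_endomorphism.

(** * Exact solutions from bounded approximate ones *)

Section riesz.
Context {R : realType} {M : weight_seq R}.
Local Notation I := (unit_interval R).
Variables (phi : I -> I) (phiM : induces_endo M phi).
Implicit Types (f g h : Dfun M) (x y z : I).
Local Notation T := (endo phiM).
Hypothesis cT : compact_operator T.

(** If [v] is a cluster point of [T (u m)], then [l *: u m], which is nearly [T (u m) - g], clusters
    at [v - g]. This gives surjectivity when applied to Neumann sums, and the bound on the inverse
    when [g = 0]. *)
Lemma approx_preimage (l : R[i]) (u : nat -> Dfun M) b g : l != 0 ->
  (forall n, Dn (u n) <= b) ->
  (forall e, 0 < e -> exists m0, forall m, (m0 <= m)%N ->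
    Dn (T (u m) - l *: u m - g) <= e) ->
  exists2 h, T h - l *: h = g &
    forall e, 0 < e -> exists m, Dn (u m - h) < e.
Proof.
move=> l0 ub ug; have [v vP] := compact_operator_seq cT ub.
have nl := normc_gt0 l0.
pose h := l^-1 *: (v - g).
have key e : 0 < e -> exists m, Dn (u m - h) < e /\
    Dn (T (u m) - l *: u m - g) <= e.
  move=> e0; have [d [d0 d1 d2]] : exists d : R,
      [/\ 0 < d, d <= normc l * (e / 2) & d <= e].
    exists (Num.min (normc l * (e / 2)) e).
    by rewrite lt_min e0 !ge_min !lexx orbT !mulr_gt0// invr_gt0.
  have [m0 m0P] := ug d d0; have [m m0m h3] := vP d m0 d0.
  have h1 := le_trans (m0P m m0m) d1; have h2 := le_trans (m0P m m0m) d2.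
  exists m; split => //.
  have -> : u m - h = l^-1 *: ((T (u m) - v) - (T (u m) - l *: u m - g)).
    have -> : T (u m) - v - (T (u m) - l *: u m - g) = l *: u m - (v - g).
      by rewrite -[T (u m) - l *: u m - g]addrA -opprD subr_subl opprB addrA.
    by rewrite scalerBr scalerA mulVf// scale1r.
  rewrite DnZ Normc.normcV mulrC ltr_pdivrMr// mulrC.
  rewrite (le_lt_trans (DnB _ _))//.
  by rewrite (lt_le_trans (ltr_leD (lt_le_trans h3 d1) h1))// -mulrDr -splitr.
exists h; last by move=> e /key[m []]; exists m.
have [K K0 KP] := compact_endo_bounded cT.
apply/eqP; rewrite -subr_eq0; apply/eqP/Dn_eq0/eqP.
rewrite eq_le Dn_ge0 andbT; apply/ler_addgt0Pr => e e0; rewrite add0r.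
(* [K + normc l] bounds T - l on [u m - h]; the 1 accounts for the residual of [u m]. *)
pose c := K + normc l + 1; have c0 : 0 < c by rewrite ltr_wpDl// addr_ge0// ltW.
have [|m [h1 h2]] := key (e / c); first by rewrite divr_gt0.
have -> : T h - l *: h - g =
    (T (u m) - l *: u m - g) - (T (u m - h) - l *: (u m - h)).
  have -> : T (u m - h) - l *: (u m - h) = (T (u m) - l *: u m) - (T h - l *: h).
    by rewrite linearB scalerBr !opprB addrACA [RHS]addrACA [- T h + _]addrC.
  by rewrite subr_subl.
rewrite (le_trans (DnB _ _))// (le_trans (lerD h2 (DnB _ _)))// DnZ.
set d := Dn (u m - h) in h1 *.
have cd : (K + normc l) * d <= (K + normc l) * (e / c).
  by rewrite ler_wpM2l ?(ltW h1)// addr_ge0 ?normc_ge0.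
have eE : e = e / c + (K + normc l) * (e / c).
  by rewrite -{1}[e / c]mul1r -mulrDl /c [1 + _]addrC mulrC divfK ?gt_eqF.
by rewrite [leRHS]eE lerD2l (le_trans _ cd)// mulrDl lerD2r KP.
Qed.

End riesz.

(** * Order of vanishing at the fixed point, and Taylor expansion *)

Section flat.
Context {R : realType} {M : weight_seq R}.
Local Notation I := (unit_interval R).
Variable x0 : I.
Implicit Types (f g : Dfun M) (h : cfun R) (y z : I).

(** A growth condition instead of vanishing derivatives: composition with [phi] then preserves it
    without a formula for higher derivatives of composites. *)
Definition flat k h := exists2 B : R, 0 <= B &
  forall y, normc (h y) <= B * `|\val y - \val x0| ^+ k.

Lemma flat_lin k (a : R[i]) f g : flat k f -> flat k g -> flat k (a *: f + g).
Proof.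
move=> [B B0 fB] [B' B'0 gB]; exists (normc a * B + B').
  by rewrite addr_ge0// mulr_ge0// normc_ge0.
move=> y; rewrite [X in normc X](_ : _ = a * f y + g y)//.
rewrite (le_trans (le_normcD _ _))// Normc.normcM mulrDl -mulrA lerD//.
by rewrite ler_wpM2l// normc_ge0.
Qed.

Lemma flatS k h : flat k.+1 h -> flat k h.
Proof.
move=> [B B0 hB]; exists B => // y; rewrite (le_trans (hB y))// ler_wpM2l//.
by rewrite exprS ler_piMl ?exprn_ge0// dist_le1.
Qed.

Lemma flat_leq k m h : (k <= m)%N -> flat m h -> flat k h.
Proof.
by move=> /subnKC<-; elim: (m - k)%N => [|n IHn]; rewrite ?addn0// addnS => /flatS.
Qed.

Lemma flat0 f : flat 0 f.
Proof. by exists (Dn f) => [|y]; rewrite ?Dn_ge0// expr0 mulr1 Dfun_le. Qed.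

(** Induction on [k] through the derivative: each use of the mean value inequality gains one power
    of the distance. *)
Lemma flat_of_cderivn k h B : smooth h -> 0 <= B ->
  (forall j, (j < k)%N -> cderivn j h x0 = 0) ->
  (forall y, normc (cderivn k h y) <= B) ->
  forall y, normc (h y) <= B * `|\val y - \val x0| ^+ k.
Proof.
elim: k h => [|k IHk] h sh B0 h0 hB y; first by rewrite expr0 mulr1; exact: hB.
have cS j : cderivn j (cderiv h) = cderivn j.+1 h by rewrite /cderivn iterSr.
have sh' : smooth (cderiv h) by move=> j x; rewrite cS.
have h'B z : normc (cderiv h z) <= B * `|\val z - \val x0| ^+ k.
  by apply: IHk => // [j jk|w]; rewrite cS ?h0//; exact: hB.
have h00 : h x0 = 0 by exact: (h0 0%N).
rewrite -[h y]subr0 -h00 exprSr mulrA; apply: mean_value_norm.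
- by rewrite mulr_ge0// exprn_ge0.
- exact: (sh 0%N).
move=> z zy; rewrite (le_trans (h'B z))// ler_wpM2l//.
by rewrite lerXn2r ?nnegrE.
Qed.

Lemma flat_Dfun k f : (forall j, (j < k)%N -> cderivn j f x0 = 0) -> flat k f.
Proof.
move=> f0; have Mf : 0 <= M k * Dn f by rewrite mulr_ge0 ?Dn_ge0// ltW// weight_gt0.
exists (M k * Dn f) => //; apply: flat_of_cderivn => // [|y].
  exact: Dfun_smooth.
exact: cderivn_le.
Qed.

Lemma fact_neq0 k : (k`!%:R : R[i]) != 0.
Proof. by rewrite pnatr_eq0 -lt0n fact_gt0. Qed.

(** The Taylor term cancels the derivative of order [k] at [x0] and leaves the lower ones zero, so
    [flat_Dfun] applies at order [k.+1]. *)
Lemma flat_taylor_cderivn k f : (forall j, (j < k)%N -> cderivn j f x0 = 0) ->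
  flat k.+1 (f - ((cderivn k f x0 : R[i]) / k`!%:R : R[i]) *: Dpol M 'X^k x0).
Proof.
move=> f0; set c := _ / _; rewrite addrC -scaleNr; apply: flat_Dfun => j.
have -> : cderivn j ((- c) *: Dpol M 'X^k x0 + f) =
    (- c) *: cderivn j (pol 'X^k x0) + cderivn j f.
  apply: (cderivn_linear (- c) j); first exact: smooth_pol.
  exact: Dfun_smooth.
rewrite cderivn_pol derivnXn ltnS leq_eqVlt => /predU1P[->|jk].
  rewrite subnn expr0 ffactnn.
  change (- c * (1 *+ k`! : {poly R[i]}).[(\val x0 - \val x0)%:C]
    + cderivn k f x0 = 0 :> R[i]).
  by rewrite hornerMn hornerC mulNr (divfK (fact_neq0 k)) addNr.
change (- c * ('X^(k - j) *+ k ^_ j : {poly R[i]}).[(\val x0 - \val x0)%:C]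
  + cderivn j f x0 = 0 :> R[i]).
have -> : cderivn j f x0 = 0 :> R[i] by exact: f0.
rewrite addr0 hornerMn hornerXn subrr -(subnSK jk) exprS mul0r mul0rn.
by rewrite mulr0.
Qed.

(** Cancelling the [k]-th power of the distance leaves [normc c <= B * |y - x0|], and [x0] is not
    isolated in [0,1]. *)
Lemma monomial_flat k (c : R[i]) : flat k.+1 (c *: Dpol M 'X^k x0) -> c = 0.
Proof.
move=> [B B0 cB]; apply/eqP; apply/negPn/negP => c0.
have nc := normc_gt0 c0.
have [y [yx yd]] : exists y, y != x0 /\ `|\val y - \val x0| < normc c / (B + 1).
  apply: (@filter_ex _ _ (dnbhs_unit_interval_proper x0)).
  apply/dnbhs_unit_intervalP; exists (normc c / (B + 1)) => //.
  by rewrite divr_gt0// ltr_wpDl.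
have t0 : 0 < `|\val y - \val x0|.
  by rewrite normr_gt0 subr_eq0; apply: contra yx => /eqP/val_inj ->.
have := cB y; rewrite [X in normc X](_ : _ = c * ('X^k).[(\val y - \val x0)%:C])//.
rewrite hornerXn Normc.normcM normcX normc_real exprS mulrA ler_pM2r ?exprn_gt0//.
rewrite leNgt => /negP; apply; move: yd; rewrite ltr_pdivlMr ?ltr_wpDl//.
by apply: le_lt_trans; rewrite mulrC ler_pM2l// lerDl.
Qed.

(** Converse of [flat_Dfun]: the Taylor term of order [k] is a difference of two functions flat of
    order [k.+1], so its coefficient vanishes. *)
Lemma flat_cderivn k f : flat k f -> forall j, (j < k)%N -> cderivn j f x0 = 0.
Proof.
elim: k => [//|k IHk] fk j; rewrite ltnS leq_eqVlt => /predU1P[->|]; last first.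
  by apply: IHk; exact: flatS.
have /flat_taylor_cderivn := IHk (flatS fk); set c := _ / _ => fc.
have /monomial_flat c0 : flat k.+1 (c *: Dpol M 'X^k x0).
  have := flat_lin (-1) fc fk.
  by rewrite scaleN1r opprB subrK.
have := divfK (fact_neq0 k) (cderivn k f x0 : R[i]).
by rewrite -/c c0 mul0r => <-.
Qed.

Lemma flat_taylor k f : flat k f ->
  exists c, flat k.+1 (f - c *: Dpol M 'X^k x0).
Proof. by move=> /flat_cderivn/flat_taylor_cderivn fk; eexists; exact: fk. Qed.

End flat.

(** * The action of T on functions flat at the fixed point *)

Section flat_endo.
Context {R : realType} {M : weight_seq R}.
Local Notation I := (unit_interval R).
Variables (phi : I -> I) (phiM : induces_endo M phi) (x0 : I).
Hypothesis fix_x0 : phi x0 = x0.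
Implicit Types (f g : Dfun M) (y z : I).
Local Notation T := (endo phiM).
Local Notation a := (cderiv (fun x => (\val (phi x))%:C) x0).

Lemma phi_taylor : exists2 B : R, 0 <= B & forall y,
  `|\val (phi y) - \val x0| <= B * `|\val y - \val x0| /\
  normc ((\val (phi y) - \val x0)%:C - a * (\val y - \val x0)%:C) <=
    B * `|\val y - \val x0| ^+ 2.
Proof.
have [j jE] := @id_in_D R M.
(* [F] is [phi - x0] as an element of D; its Taylor bounds of orders 1 and 2 are the two claims. *)
pose F : Dfun M := (- (\val x0)%:C) *: Dpol M 1 x0 + T j.
have FE y : F y = (\val (phi y) - \val x0)%:C.
  change (- (\val x0)%:C * (1 : {poly R[i]}).[(\val y - \val x0)%:C] + j (phi y)
    = (\val (phi y) - \val x0)%:C).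
  by rewrite hornerC mulr1 jE addrC rmorphB.
have F0 i : (i < 1)%N -> cderivn i F x0 = 0.
  by case: i => // _; rewrite [LHS]FE fix_x0 subrr.
have F1 : cderivn 1 F x0 = a.
  have -> : cderivn 1 F =
      (- (\val x0)%:C) *: cderivn 1 (pol 1 x0) + cderivn 1 (T j).
    apply: (cderivn_linear (- (\val x0)%:C) 1); first exact: smooth_pol.
    exact: Dfun_smooth.
  rewrite cderivn_pol derivn1 derivC pol0 scaler0 add0r.
  by congr (cderiv _ x0); apply/funext => y; rewrite -jE.
have [B1 B10 FB1] := flat_Dfun F0.
have [B2 B20 FB2] := flat_taylor_cderivn F0.
exists (B1 + B2) => [|y]; first by rewrite addr_ge0.
rewrite !mulrDl; split.
  have := FB1 y; rewrite FE normc_real expr1 => h.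
  by rewrite (le_trans h)// lerDl mulr_ge0.
have := FB2 y; rewrite F1 (_ : 1`! = 1%N)// divr1.
rewrite [X in normc X](_ : _ = F y - a * ('X^1 : {poly R[i]}).[(\val y - \val x0)%:C])//.
rewrite FE hornerXn expr1 => h.
by rewrite (le_trans h)// lerDr mulr_ge0// exprn_ge0.
Qed.

Lemma endo_flat k f : flat x0 k f -> flat x0 k (T f).
Proof.
move=> [B B0 fB]; have [L L0 phiL] := phi_taylor.
exists (B * L ^+ k) => [|y]; first by rewrite mulr_ge0// exprn_ge0.
rewrite (le_trans (fB _))// -mulrA ler_wpM2l// -exprMn.
by rewrite lerXn2r ?nnegrE ?mulr_ge0//; case: (phiL y).
Qed.

Lemma endo_monomial_flat k :
  flat x0 k.+1 (T (Dpol M 'X^k x0) - a ^+ k *: Dpol M 'X^k x0).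
Proof.
have [L L0 phiL] := phi_taylor.
suff [B B0 BP] : exists2 B : R, 0 <= B & forall y,
    normc ((\val (phi y) - \val x0)%:C ^+ k - a ^+ k * (\val y - \val x0)%:C ^+ k)
      <= B * `|\val y - \val x0| ^+ k.+1.
  exists B => // y; have := BP y; rewrite -(hornerXn (_ - _)%:C) -(hornerXn (\val y - _)%:C).
  exact.
elim: k => [|k [B B0 IHk]].
  by exists 0 => // y; rewrite !expr0 mulr1 subrr Normc.normc0 mul0r.
exists (L * B + normc a ^+ k * L) => [|y].
  by rewrite addr_ge0// mulr_ge0// exprn_ge0// normc_ge0.
have [] := phiL y; have := IHk y.
set s := \val (phi y) - _; set t := \val y - _ => h0 h1 h2.
(* The first summand is small by induction, the second because [phi] is differentiable at [x0] with
   quadratic error. *)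
have -> : s%:C ^+ k.+1 - a ^+ k.+1 * t%:C ^+ k.+1 =
  s%:C * (s%:C ^+ k - a ^+ k * t%:C ^+ k) + a ^+ k * t%:C ^+ k * (s%:C - a * t%:C).
  by rewrite !exprS; ring.
rewrite (le_trans (le_normcD _ _))// !Normc.normcM !normcX !normc_real mulrDl lerD//.
  rewrite [_ ^+ k.+2]exprS mulrACA ler_pM ?normc_ge0//.
have -> : normc a ^+ k * L * `|t| ^+ k.+2 = normc a ^+ k * `|t| ^+ k * (L * `|t| ^+ 2).
  by rewrite !exprS expr0; ring.
by rewrite ler_wpM2l// mulr_ge0// exprn_ge0// normc_ge0.
Qed.

(** Split off the Taylor term of [f]: on the monomial, T acts as [a ^+ k] up to order [k.+1], and
    the remainder stays flat of that order under T. *)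
Lemma endo_sub_flat k f : flat x0 k f -> flat x0 k.+1 (T f - a ^+ k *: f).
Proof.
move=> /flat_taylor[c fc]; set P := Dpol M 'X^k x0 in fc.
have -> : T f - a ^+ k *: f = c *: (T P - a ^+ k *: P) +
    ((- a ^+ k) *: (f - c *: P) + T (f - c *: P)).
  have -> : T (f - c *: P) = T f - c *: T P by rewrite linearB linearZ.
  rewrite !scalerBr !scaleNr opprK.
  rewrite !scalerA [a ^+ k * c]mulrC [- (a ^+ k *: f) + _]addrC.
  by rewrite [RHS]addrA subrKA [RHS]addrC subrKA.
apply: flat_lin; first exact: endo_monomial_flat.
by apply: flat_lin => //; exact: endo_flat.
Qed.

End flat_endo.

(** * Bijectivity and bounded inverse of T - l when [l] is neither 0 nor a power of [a] *)

Section resolvent.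
Context {R : realType} {M : weight_seq R}.
Local Notation I := (unit_interval R).
Variables (phi : I -> I) (phiM : induces_endo M phi) (x0 : I).
Local Notation T := (endo phiM).
Local Notation a := (cderiv (fun x => (\val (phi x))%:C) x0).
Hypothesis cT : compact_operator T.
Hypothesis fix_x0 : phi x0 = x0.
Implicit Types (f g : Dfun M) (y z : I) (l : R[i]).

(** Flatness turns the rate [r] of the iterates into [r ^+ k <= rho] for the uniform norms, and
    Ehrling's inequality with [rho / 2] carries this over to the norm. The order [k] depends on
    [rho] only. *)
Lemma flat_decay rho : 0 < rho -> exists k, forall f, flat x0 k f ->
  exists2 A : R, 0 <= A & forall n, Dn (iter n T f) <= A * rho ^+ n.
Proof.
move=> rho0; have [D [r [D0 r01 Dr]]] := iter_geometric cT fix_x0.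
have [k rk] := exprn_le_ex r01 rho0; have /andP[r0 _] := r01.
have rho20 : 0 < rho / 2 by rewrite divr_gt0.
have [C C0 CP] := compact_ehrling cT rho20.
exists k => f [B B0 fB].
have BD0 : 0 <= B * D ^+ k by rewrite mulr_ge0// exprn_ge0.
have sup n y : normc (iter n T f y) <= B * D ^+ k * rho ^+ n.
  rewrite iter_endoE (le_trans (fB _))// -mulrA ler_wpM2l//.
  rewrite (le_trans (lerXn2r k _ _ (Dr n y))) ?nnegrE ?mulr_ge0 ?exprn_ge0//.
  rewrite exprMn ler_wpM2l ?exprn_ge0// -exprM mulnC exprM.
  by rewrite lerXn2r ?nnegrE ?exprn_ge0// ltW.
(* Chosen so that [A * rho / 2 + C * (B * D ^+ k) <= A * rho], as the induction step requires;
   [Dn f] covers [n = 0]. *)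
pose A := Dn f + 2 * C * (B * D ^+ k) / rho.
have A'0 : 0 <= 2 * C * (B * D ^+ k) / rho.
  by rewrite divr_ge0 ?(ltW rho0)// mulr_ge0// mulr_ge0.
exists A => [|n]; first by rewrite addr_ge0// Dn_ge0.
elim: n => [|n IHn]; first by rewrite expr0 mulr1 lerDl.
rewrite iterS (le_trans (CP _ _ (sup n)))//.
apply: (@le_trans _ _ (rho / 2 * (A * rho ^+ n) + C * (B * D ^+ k * rho ^+ n))).
  by rewrite lerD2r ler_wpM2l// ltW.
rewrite exprS; set p := rho ^+ n; have p0 : 0 <= p by rewrite exprn_ge0// ltW.
have -> : rho / 2 * (A * p) + C * (B * D ^+ k * p) =
    (A * rho / 2 + C * (B * D ^+ k)) * p by ring.
rewrite [leRHS]mulrA ler_wpM2r//.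
have Ar : A * rho = Dn f * rho + 2 * C * (B * D ^+ k).
  by rewrite mulrDl divfK ?gt_eqF.
have : 0 <= Dn f * rho by rewrite mulr_ge0 ?Dn_ge0// ltW.
rewrite Ar; set q := C * (B * D ^+ k); set d := Dn f * rho.
by rewrite -mulrA -/q; lra.
Qed.

Variable l : R[i].
Hypothesis l_neq0 : l != 0.
Hypothesis l_neqX : forall n, l != a ^+ n.

Let nl : 0 < normc l := normc_gt0 l_neq0.
Let nl2 : 0 < normc l / 2. Proof. by rewrite divr_gt0. Qed.

(** An eigenfunction is flat of every order, as [(l - a ^+ j) *: f] gains one order; then its
    iterates have size |l|^n ||f|| and yet are O((|l|/2)^n). *)
Lemma eigen_eq0 f : T f = l *: f -> f = 0.
Proof.
move=> Tf; have [k kP] := flat_decay nl2.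
have ff j : flat x0 j f.
  elim: j => [|j IHj]; first exact: flat0.
  have := endo_sub_flat phiM fix_x0 IHj; rewrite Tf -scalerBl => lf.
  have la : l - a ^+ j != 0 by rewrite subr_eq0.
  rewrite -[f](scale1r f) -(mulVf la) -scalerA -[_ *: (_ *: f)]addr0.
  apply: flat_lin lf _.
  by exists 0 => // y; rewrite [X in X <= _]Normc.normc0 mul0r.
have [A A0 AP] := kP f (ff k).
have itl n : iter n T f = l ^+ n *: f.
  elim: n => [|n IHn]; first by rewrite expr0 scale1r.
  by rewrite iterS IHn linearZ/= Tf scalerA exprSr.
have fA n : Dn f <= A * (1 / 2) ^+ n.
  have := AP n; rewrite itl DnZ normcX => h.
  rewrite -(ler_pM2l (exprn_gt0 n nl)) (le_trans h)//.
  by rewrite exprMn mul1r mulrCA.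
apply: Dn_eq0; apply/eqP; rewrite eq_le Dn_ge0 andbT.
apply/ler_addgt0Pr => e e0; rewrite add0r.
have [||n nP] := @exprn_le_ex R (1 / 2) (e / (A + 1)); first by lra.
  by rewrite divr_gt0// ltr_wpDl.
rewrite (le_trans (fA n))// (le_trans (ler_wpM2l A0 nP))//.
by rewrite mulrCA ler_piMr ?(ltW e0)// ler_pdivrMr ?ltr_wpDl// mul1r lerDl.
Qed.

Lemma flat_solve : exists k, forall g, flat x0 k g -> exists f, T f - l *: f = g.
Proof.
have [k kP] := flat_decay nl2; exists k => g /kP[A A0 AP].
(* Neumann sums: [u m] is minus the sum of l^-(i+1) T^i g over i < m. Its residual telescopes to the
   single term in [uE]. *)
pose u := fix u m : Dfun M :=
  if m is m'.+1 then u m' - l^-1 ^+ m'.+1 *: iter m' T g else 0.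
have itA m : Dn (l^-1 ^+ m *: iter m T g) <= A * (1 / 2) ^+ m.
  rewrite DnZ normcX Normc.normcV exprVn.
  rewrite mulrC ler_pdivrMr ?exprn_gt0// (le_trans (AP m))// -mulrA -exprMn.
  by rewrite [1 / 2 * _]mulrC mul1r.
have uE m : T (u m) - l *: u m - g = - (l^-1 ^+ m *: iter m T g).
  elim: m => [|m IHm].
    by rewrite /= linear0 scaler0 subr0 sub0r expr0 scale1r.
  rewrite /u -/u.
  have -> : T (u m - l^-1 ^+ m.+1 *: iter m T g) =
      T (u m) - l^-1 ^+ m.+1 *: iter m.+1 T g by rewrite linearB linearZ.
  have lw : l * l^-1 ^+ m.+1 = l^-1 ^+ m by rewrite exprS mulrA divff// mul1r.
  rewrite scalerBr scalerA lw opprD addrACA -opprD [LHS]addrAC IHm.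
  by rewrite opprB addrA addNr sub0r.
(* The partial sum of the geometric series, kept exact so that the induction closes. *)
have uA m : Dn (u m) <= 2 * A / normc l * (1 - (1 / 2) ^+ m).
  elim: m => [|m IHm]; first by rewrite /= Dn0 expr0 subrr mulr0.
  rewrite [u _.+1]/= (le_trans (DnB _ _))// exprS -scalerA DnZ Normc.normcV.
  have := itA m; move: IHm; rewrite exprS; set p := (1 / 2) ^+ m.
  set d := Dn _; set w := Dn _ => h1 h2.
  have -> : 2 * A / normc l * (1 - 1 / 2 * p) =
      2 * A / normc l * (1 - p) + (normc l)^-1 * (A * p) by field; rewrite gt_eqF.
  by rewrite lerD// ler_wpM2l// invr_ge0 ltW.
have [||f fg _] := @approx_preimage _ _ _ _ cT l u (2 * A / normc l) g l_neq0.
- move=> m; rewrite (le_trans (uA m))//; apply: ler_piMr.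
    by rewrite divr_ge0 ?mulr_ge0// ltW.
  by rewrite gerBl exprn_ge0// divr_ge0.
- move=> e e0; have [||m0 m0P] := @exprn_le_ex R (1 / 2) (e / (A + 1)); first by lra.
    by rewrite divr_gt0// ltr_wpDl.
  exists m0 => m m0m; rewrite uE DnN (le_trans (itA m))//.
  have h2 : (1 / 2) ^+ m <= (1 / 2) ^+ m0 :> R by apply: ler_wiXn2l => //; lra.
  rewrite (le_trans (ler_wpM2l A0 (le_trans h2 m0P)))//.
  by rewrite mulrCA ler_piMr ?(ltW e0)// ler_pdivrMr ?ltr_wpDl// mul1r lerDl.
by exists f.
Qed.

Lemma resolvent_surj g : exists f, T f - l *: f = g.
Proof.
have [k kP] := flat_solve.
suff [p pk] : exists p, flat x0 k (g - (T p - l *: p)).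
  have [f fE] := kP _ pk; exists (f + p).
  have -> : T (f + p) - l *: (f + p) = (T f - l *: f) + (T p - l *: p).
    by rewrite linearD scalerDr opprD addrACA.
  by rewrite fE subrK.
elim: k {kP} => [|k [p pk]]; first by exists 0; exact: flat0.
set h := g - _ in pk.
have la : a ^+ k - l != 0 by rewrite subr_eq0 eq_sym.
(* On the residual [h], T - l is multiplication by [a ^+ k - l] up to order [k.+1], so this
   correction raises the flatness of the residual by one. *)
exists (p + (a ^+ k - l)^-1 *: h).
have := endo_sub_flat phiM fix_x0 pk; set q := T h - _ => qk.
have -> : g - (T (p + (a ^+ k - l)^-1 *: h) - l *: (p + (a ^+ k - l)^-1 *: h)) =
    (- (a ^+ k - l)^-1) *: q + 0.
  have -> : T (p + (a ^+ k - l)^-1 *: h) =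
    T p + (a ^+ k - l)^-1 *: T h by rewrite linearD linearZ.
  rewrite addr0 scalerDr [X in g - X](_ : _ = (T p - l *: p) +
    ((a ^+ k - l)^-1 *: T h - l *: ((a ^+ k - l)^-1 *: h))); last first.
    by rewrite opprD addrACA.
  rewrite opprD addrA -/h.
  have hb : h = (a ^+ k - l)^-1 *: ((a ^+ k - l) *: h).
    by rewrite scalerA mulVf ?scale1r.
  rewrite scalerA [l * _]mulrC -scalerA -scalerBr {1}hb -scalerBr scaleNr -scalerN.
  by congr (_ *: _); rewrite scalerBl !opprB subrKA.
apply: flat_lin qk _.
by exists 0 => // y; rewrite [X in X <= _]Normc.normc0 mul0r.
Qed.

(** Otherwise unit vectors [u n] with [T (u n) - l *: u n] tending to 0 would come arbitrarily near
    an eigenfunction, which is 0. *)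
Lemma resolvent_bound : exists2 c : R, 0 < c &
  forall f, Dn f <= c * Dn (T f - l *: f).
Proof.
apply: contrapT => nex.
have ex n : exists f, Dn f = 1 /\ Dn (T f - l *: f) <= n.+1%:R^-1.
  apply: contrapT => nf; apply: nex; exists n.+1%:R => // f.
  rewrite leNgt; apply/negP => fn; apply: nf.
  have f0 : 0 < Dn f by rewrite (le_lt_trans _ fn)// mulr_ge0// Dn_ge0.
  have nf : normc ((Dn f)^-1)%:C = (Dn f)^-1 by rewrite normc_real ger0_norm// invr_ge0 ltW.
  exists (((Dn f)^-1)%:C *: f).
  have -> : T (((Dn f)^-1)%:C *: f) - l *: (((Dn f)^-1)%:C *: f) =
      ((Dn f)^-1)%:C *: (T f - l *: f).
    by rewrite linearZ scalerBr !scalerA mulrC.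
  rewrite !DnZ nf mulVf ?gt_eqF//; split=> //.
  by rewrite mulrC ler_pdivrMr// ler_pdivlMl// ltW.
have [u uP] := choice ex.
have [||h hE hu] := @approx_preimage _ _ _ _ cT l u 1 0 l_neq0.
- by move=> n; case: (uP n) => ->.
- move=> e e0; have [m0 _ m0P] := near_infty_natSinv_lt (PosNum e0).
  exists m0 => m m0m; rewrite subr0; case: (uP m) => _ h.
  by rewrite (le_trans h)// ltW//; exact: m0P.
have h0 : h = 0 by apply: eigen_eq0; apply/eqP; rewrite -subr_eq0 hE.
have [|m] := hu (1 / 2); first by lra.
by rewrite h0 subr0; case: (uP m) => -> _; lra.
Qed.

End resolvent.

(** * Determination of the spectrum *)

Section spectrum_endo.
Context {R : realType} {M : weight_seq R}.
Local Notation I := (unit_interval R).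
Variables (phi : I -> I) (phiM : induces_endo M phi).
Local Notation T := (endo phiM).
Hypothesis cT : compact_operator T.
Implicit Types (f g : Dfun M) (y z : I) (l : R[i]).

Lemma Dn_bounded_continuous (S : {linear Dfun M -> Dfun M}) (c : R) :
  (forall f, Dn (S f) <= c * Dn f) -> continuous S.
Proof.
move=> Sc; apply/linear_bounded_continuous/linear_boundedP.
exists c%:C; split; first by rewrite realE !lecR; exact: le_total.
move=> r cr f; rewrite (le_trans _ (ler_wpM2r _ (ltW cr)))//.
by rewrite !DnE -rmorphM lecR.
Qed.

Lemma continuous_Dn_bounded (S : {linear Dfun M -> Dfun M}) : continuous S ->
  exists2 c : R, 0 < c & forall f, Dn (S f) <= c * Dn f.
Proof.
move=> /linear_bounded_continuous/linear_boundedP/pinfty_ex_gt0[r r0 rP].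
have rE : r = (complex.Re r)%:C by rewrite RRe_real// gtr0_real.
exists (complex.Re r); first by rewrite -ltcR -rE.
by move=> f; have := rP f; rewrite !DnE {1}rE -rmorphM lecR.
Qed.

(** If [c] bounds an inverse, Ehrling's inequality with [(2 * c)^-1] absorbs half of the norm and
    leaves a multiple of the uniform norm, which a spike of slope 1 contradicts. *)
Lemma spectrum_endo0 : spectrum T 0.
Proof.
move=> [S [/continuous_Dn_bounded[c c0 Sc] ST _]].
have c1 : 0 < (2 * c)^-1 by rewrite invr_gt0 mulr_gt0.
have [C C0 CP] := compact_ehrling cT c1.
have M1 := weight_gt0 M 1.
have Df f s : (forall y, normc (f y) <= s) -> Dn f <= 2 * c * (C * s).
  move=> fs; have := Sc (T f).
  have -> : S (T f) = f by have := ST f; rewrite scale0r subr0.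
  have := CP f s fs; rewrite -(ler_pM2l c0) mulrDr [c * (_ * _)]mulrA.
  have -> : c * (2 * c)^-1 = 1 / 2 by field; rewrite gt_eqF.
  by rewrite -[2 * c * _]mulrA; set q := c * (C * s); lra.
pose e := (2 * (M 1%N * (2 * c * (C + 1))))^-1.
have e0 : 0 < e by rewrite invr_gt0 !mulr_gt0// ltr_wpDl.
have [p [p1 pe]] := spike_ex e0; have [pt _] := unit_interval0 R.
have := cderivn_le (Dpol M p pt) 1 pt; rewrite cderivn_pol /pol subrr p1.
rewrite Normc.normc1; apply/negP; rewrite -ltNge.
apply: (@le_lt_trans _ _ (M 1%N * (2 * c * (C * e)))).
  by rewrite ler_pM2l//; apply: Df => y; exact: pe.
apply: (@le_lt_trans _ _ (M 1%N * (2 * c * ((C + 1) * e)))).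
  rewrite ler_pM2l// ler_pM2l ?mulr_gt0// ler_wpM2r ?(ltW e0)//.
  by rewrite lerDl.
have -> : M 1%N * (2 * c * ((C + 1) * e)) = 1 / 2; last by lra.
by rewrite /e; field; rewrite !gt_eqF// ltr_wpDl.
Qed.

Variable x0 : I.
Hypothesis fix_x0 : phi x0 = x0.
Local Notation a := (cderiv (fun x => (\val (phi x))%:C) x0).

(* For the least n with a ^ n = a ^ m, the function (x - x0) ^ n is not in the
   range of T - a ^ n. *)
Lemma spectrum_endoX m : a ^+ m != 0 -> spectrum T (a ^+ m).
Proof.
move=> am0 [S [_ _ TS]].
have exn : exists n, a ^+ n == a ^+ m by exists m.
have [n /eqP nE nmin] := ex_minnP exn.
have := TS (Dpol M 'X^n x0); set f := S _; rewrite -nE; set P := Dpol _ _ _ => fP.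
have Pn : flat x0 n P.
  exists 1 => // y; rewrite mul1r [X in normc X](_ : _ = ('X^n).[(\val y - \val x0)%:C])//.
  by rewrite hornerXn normcX normc_real.
have fk k : (k <= n)%N -> flat x0 k f.
  elim: k => [_|k IHk kn]; first exact: flat0.
  have := endo_sub_flat phiM fix_x0 (IHk (ltnW kn)) => qk.
  have ka : a ^+ k - a ^+ n != 0.
    by rewrite subr_eq0; apply: contraL kn; rewrite nE => /nmin; rewrite -leqNgt.
  (* Solve T f - a^n f = P for [f] through (T f - a^k f) + (a^k - a^n) f = P: both known terms are
     flat of order [k.+1]. *)
  have -> : f = (- (a ^+ k - a ^+ n)^-1) *: (T f - a ^+ k *: f) +
      ((a ^+ k - a ^+ n)^-1 *: P + 0).
    rewrite addr0 -fP scaleNr addrC -scalerBr subr_subl -scalerBl scalerA mulVf//.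
    by rewrite scale1r.
  apply: flat_lin qk _; apply: flat_lin; first exact: flat_leq kn Pn.
  by exists 0 => // y; rewrite [X in X <= _]Normc.normc0 mul0r.
have := endo_sub_flat phiM fix_x0 (fk n (leqnn n)); rewrite fP.
rewrite -[P]scale1r => /monomial_flat/eqP.
by rewrite oner_eq0.
Qed.

Lemma spectrum_endo_sub l : l != 0 -> (forall n, l != a ^+ n) -> ~ spectrum T l.
Proof.
move=> l0 la; apply.
have [s sP] := choice (resolvent_surj cT fix_x0 l0 la).
have inj f g : T f - l *: f = T g - l *: g -> f = g.
  move=> fg; apply/eqP; rewrite -subr_eq0; apply/eqP.
  apply: (eigen_eq0 cT fix_x0 l0 la); rewrite linearB scalerBr.
  by apply/eqP; rewrite -subr_eq0 opprD addrACA -opprD fg subrr.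
(* The chosen preimages depend linearly on the right-hand side because they are unique. *)
have slin : linear s.
  move=> b f g; apply: inj; rewrite sP linearP scalerDr opprD addrACA sP.
  by rewrite scalerA [l * b]mulrC -scalerA -scalerBr sP.
pose Smix := GRing.isLinear.Build _ _ _ _ s slin.
pose S : {linear Dfun M -> Dfun M} := HB.pack s Smix.
exists S; split.
- have [c _ cP] := resolvent_bound cT fix_x0 l0 la.
  by apply: (@Dn_bounded_continuous S c) => f; have := cP (s f); rewrite sP.
- by move=> f; apply: inj; rewrite sP.
- exact: sP.
Qed.

End spectrum_endo.
Theorem theorem2p4 (R : realType) (M : weight_seq R)
    (phi : unit_interval R -> unit_interval R) (phiM : induces_endo M phi)
    (x0 : unit_interval R) :
  compact_operator (endo phiM) ->
  unique (fun x => phi x = x) x0 ->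
  spectrum (endo phiM) =
    [set (cderiv (fun x => (\val (phi x))%:C) x0) ^+ n | n in [set n | 0 < n]%N]
    `|` [set 0; 1].
Proof.
move=> cT [fix_x0 _]; set a := cderiv _ x0; apply/seteqP; split => [l lS|l].
- have [->|l0] := eqVneq l 0; first by right; left.
  have [[n ln]|nex] := pselect (exists n, l = a ^+ n).
    (* The exponent 0 yields the value 1, listed apart from the positive powers. *)
    case: n ln => [->|n ->]; first by right; right; rewrite expr0.
    by left; exists n.+1.
  by case: (spectrum_endo_sub cT fix_x0 l0 _ lS) => n; apply/eqP => ln;
    apply: nex; exists n.
- have X n : spectrum (endo phiM) (a ^+ n).
    (* A vanishing power, which occurs when [a = 0], falls under the spectral value 0. *)
    have [->|an0] := eqVneq (a ^+ n) 0; first exact: spectrum_endo0.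
    exact: spectrum_endoX.
  case=> [[n _ <-]|[->|->]]; [exact: X|exact: spectrum_endo0|].
  by rewrite -(expr0 a); exact: X.
Qed.
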